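(* Let $\mathbb{T}$ be an equivalence on the category of frames, let $L$ be a frame and let $S$ be the Sierpinski locale. Then $\mathbb{T}$ induces (via $f\mapsto\mathbb{T}f$) an order preserving function $\mathrm{Arr}\langle S,L\rangle\to\mathrm{Arr}\langle\mathbb{T}S,\mathbb{T}L\rangle$ which possesses an order preserving inverse function.
   Context: A frame is a complete lattice satisfying $a\wedge\bigvee_{i\in I}b_i=\bigvee_{i\in I}(a\wedge b_i)$. The arrows of the category of frames are the functions preserving finite meets (including the top element $1$) and arbitrary joins (including the bottom element $0$). The Sierpinski locale is the three-element chain $S=\{0<a<1\}$, regarded as a frame. $\mathrm{Arr}\langle A,B\rangle$ denotes the set of arrows of the category of frames with source $A$ and target $B$, with the pointwise partial order: $f\leq g$ iff $f(x)\leq g(x)$ for all $x\in A$. An equivalence on a category $\mathcal{C}$ is a functor $\mathcal{C}\to\mathcal{C}$ which is full and faithful and has a full and faithful left adjoint. *)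

(* Defs.v *)
From HB Require Import structures.
From mathcomp Require Import all_boot all_order boolp classical_sets.

Set Implicit Arguments.
Unset Strict Implicit.
Unset Printing Implicit Defensive.

Import Order.Theory.
Local Open Scope classical_set_scope.
Local Open Scope order_scope.

Record category := Category {
  obj :> Type;
  arr : obj -> obj -> Type;
  idarr : forall A, arr A A;
  comp : forall A B C, arr B C -> arr A B -> arr A C;
  comp1f : forall A B (f : arr A B), comp (idarr B) f = f;
  compf1 : forall A B (f : arr A B), comp f (idarr A) = f;
  compfA : forall A B C D (h : arr C D) (g : arr B C) (f : arr A B),
    comp h (comp g f) = comp (comp h g) f }.

Arguments arr {c} A B.
Arguments idarr {c} A.
Arguments comp {c A B C} g f.

Record functor (C D : category) := Functor {
  fobj :> C -> D;
  farr : forall A B : C, arr A B -> arr (fobj A) (fobj B);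
  farr1 : forall A : C, farr (idarr A) = idarr (fobj A);
  farr_comp : forall (A B E : C) (g : arr B E) (f : arr A B),
    farr (comp g f) = comp (farr g) (farr f) }.

Arguments farr {C D} F {A B} f : rename.

Definition full (C D : category) (F : functor C D) : Prop :=
  forall (A B : C) (g : arr (F A) (F B)), exists f : arr A B, farr F f = g.

Definition faithful (C D : category) (F : functor C D) : Prop :=
  forall A B : C, injective (@farr C D F A B).

(* [F] is left adjoint to [G]: unit, counit and the triangle identities. *)
Definition left_adjoint (C D : category)
    (F : functor D C) (G : functor C D) : Prop :=
  exists (eta : forall X : D, arr X (G (F X)))
         (eps : forall A : C, arr (F (G A)) A),
    [/\ forall (X Y : D) (f : arr X Y),
          comp (farr G (farr F f)) (eta X) = comp (eta Y) f,
        forall (A B : C) (f : arr A B),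
          comp f (eps A) = comp (eps B) (farr F (farr G f)),
        forall X : D, comp (eps (F X)) (farr F (eta X)) = idarr (F X)
      & forall A : C, comp (farr G (eps A)) (eta (G A)) = idarr (G A)].

Definition is_equivalence (C : category) (T : functor C C) : Prop :=
  [/\ full T, faithful T
    & exists F : functor C C, [/\ full F, faithful F & left_adjoint F T]].

(* [supremums A] is the set of least upper bounds of [A]. *)
HB.mixin Record isFrame (d : Order.disp_t) T of Order.TBLattice d T := {
  fsup : set T -> T;
  fsupP : forall A : set T, supremums A (fsup A);
  meet_fsupr : forall (a : T) (B : set T),
    a `&` fsup B = fsup [set a `&` b | b in B] }.

#[short(type="frameType")]
HB.structure Definition Frame (d : Order.disp_t) :=
  { T of isFrame d T & Order.TBLattice d T }.

(* The display is only a notational tag of MathComp orders; it is packed so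
   that frames with different displays are objects of one category. *)
Record frame := Frm { frame_disp : Order.disp_t;
                      frame_sort :> frameType frame_disp }.

(* Preservation of the bottom element is the case [X = set0] of [fhom_sup]. *)
Record frame_hom (A B : frame) := FrameHom {
  fhom_fun :> A -> B;
  fhom_meet : forall x y : A, fhom_fun (x `&` y) = fhom_fun x `&` fhom_fun y;
  fhom_top : fhom_fun \top = \top;
  fhom_sup : forall X : set A, fhom_fun (fsup X) = fsup (fhom_fun @` X) }.

Lemma frame_hom_eq (A B : frame) (f g : frame_hom A B) : f =1 g -> f = g.
Proof.
case: f g => [f fm ft fs] [g gm gt gs] /= /funext fg.
rewrite -fg in gm gt gs *; congr FrameHom; exact: Prop_irrelevance.
Qed.

Definition frame_id (A : frame) : frame_hom A A.
Proof.
by exists idfun => // X; rewrite image_id.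
Defined.

Definition frame_comp (A B C : frame) (g : frame_hom B C) (f : frame_hom A B) :
  frame_hom A C.
Proof.
exists (g \o f) => [x y||X] /=.
- by rewrite !fhom_meet.
- by rewrite !fhom_top.
- by rewrite !fhom_sup -image_comp.
Defined.

Lemma frame_comp1f (A B : frame) (f : frame_hom A B) :
  frame_comp (frame_id B) f = f.
Proof. exact: frame_hom_eq. Qed.

Lemma frame_compf1 (A B : frame) (f : frame_hom A B) :
  frame_comp f (frame_id A) = f.
Proof. exact: frame_hom_eq. Qed.

Lemma frame_compA (A B C D : frame)
    (h : frame_hom C D) (g : frame_hom B C) (f : frame_hom A B) :
  frame_comp h (frame_comp g f) = frame_comp (frame_comp h g) f.
Proof. exact: frame_hom_eq. Qed.

Definition frames : category :=
  Category frame_comp1f frame_compf1 frame_compA.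

Definition fhom_le (A B : frame) (f g : frame_hom A B) : Prop :=
  forall x : A, f x <= g x.

Section FiniteFrame.
Variables (d : Order.disp_t) (T : finTBDistrLatticeType d).

Definition fin_sup (A : set T) : T := \join_(x : T | `[< A x >]) x.

Lemma fin_supP (A : set T) : supremums A (fin_sup A).
Proof.
split=> [x Ax|y yA]; first by apply: (@joins_sup _ _ _ x) => //; exact/asboolP.
by apply/joinsP => x /asboolP; exact: yA.
Qed.

Lemma meet_fin_supr (a : T) (B : set T) :
  a `&` fin_sup B = fin_sup [set a `&` b | b in B].
Proof.
apply/le_anti/andP; split; last first.
  rewrite lexI; apply/andP; split; apply/joinsP => _ /asboolP[b Bb <-].
    exact: leIl.
  by apply: le_trans (leIr _ _) _; exact: (fin_supP B).1.
rewrite /fin_sup (big_morph _ (meetUr a) (meetx0 a)).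
by apply/joinsP => b /asboolP Bb; apply: (fin_supP _).1; exists b.
Qed.

End FiniteFrame.

(* MathComp proves these two facts but does not export the instances. *)
HB.instance Definition _ (n : nat) :=
  @Order.hasBottom.Build _ 'I_n.+1 ord0 (@leq0n).
HB.instance Definition _ (n : nat) :=
  @Order.hasTop.Build _ 'I_n.+1 ord_max (@leq_ord n).

(* The chain [0 < 1 < ... < n]. *)
HB.instance Definition _ (n : nat) :=
  isFrame.Build _ 'I_n.+1
    (@fin_supP _ _) (@meet_fin_supr _ _).

Definition sierpinski : frame := Frm 'I_3.

(* Main.v *)
From HB Require Import structures.
From mathcomp Require Import all_boot all_order.
From mathcomp Require Import boolp classical_sets.
Require Import Defs.

Set Implicit Arguments.
Unset Strict Implicit.
Unset Printing Implicit Defensive.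

Import Order.Theory.
Local Open Scope classical_set_scope.
Local Open Scope order_scope.

(** The Sierpinski frame is free on its middle element [gen]: evaluation at
    [gen] is an order isomorphism from the frame homs [sierpinski -> L] to [L].
    So once [T sierpinski] is known to be free on one generator too, the claim
    says that an equivalence [T] preserves and reflects the order of every
    frame.

    That freeness is [sierpinski_fixed].  Any element other than [\bot] and
    [\top] generates a copy of the Sierpinski frame, and a faithful functor
    cannot send [sierpinski] to a frame without such elements, because it has
    to separate the two homs from [sierpinski] to the two-element frame.  So,
    with [F] the left adjoint, [sierpinski] embeds into [F sierpinski], hence
    [T sierpinski] embeds into [T (F sierpinski)], which is [sierpinski]; and
    [sierpinski] embeds into [T sierpinski].  Between three-element chains
    this leaves only isomorphisms.

    Transporting the generator along that isomorphism turns [T] into a family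
    of bijections [tau : L -> T L] between underlying sets, natural in [L].
    It remains to show that every such family is an order isomorphism
    ([tau_le]).  On the two-element frame [tau] keeps the order or reverses it.
    Reversal would make every frame hom preserve infima, which fails: on the
    chain [0 < ... < 1/3 < 1/2 < 1], the hom to the two-element frame detecting
    the nonzero elements does not preserve the infimum of the [1/n]
    ([tau_two_bot]).  This is the one place where an infinite frame is needed:
    the passage to the opposite lattice is an autoequivalence of finite
    distributive lattices, and it reverses the order of homs.

    Once [tau] keeps the order of the two-element frame, it keeps the order of
    finite chains, which are separated by their homs to it; and a pair
    [x <= y] in [L] is the same thing as a hom to [L] from the four-element
    chain, so order in [L] and in [T L] can both be read off such homs. *)

(** * Equivalences of categories *)

Definition mono (C : category) (A B : C) (m : arr A B) : Prop :=
  forall (X : C) (p q : arr X A), comp m p = comp m q -> p = q.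

(** Fullness of [F] turns the counit at [F X] into an arrow [T (F X) -> X]; it
    inverts the unit by the two triangle identities. *)
Lemma unit_iso (C : category) (F G : functor C C) :
    full F -> faithful F -> left_adjoint F G ->
  forall X : C, exists (u : arr X (G (F X))) (v : arr (G (F X)) X),
    comp v u = idarr X /\ comp u v = idarr (G (F X)).
Proof.
move=> fullF faithF [eta [eps [eta_nat _ tri1 tri2]]] X.
have [g Fg] := fullF _ _ (eps (F X)).
exists (eta X), g; split.
  by apply: faithF; rewrite farr_comp Fg tri1 farr1.
by rewrite -eta_nat Fg tri2.
Qed.

(** Every object [X] is isomorphic to [T (F X)], and the arrows from
    [T (F X)] to [T A] are images of arrows from [F X] to [A], on which monicity
    of [m] can be used. *)
Lemma equivalence_mono (C : category) (T : functor C C) (A B : C)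
    (m : arr A B) :
  is_equivalence T -> mono m -> mono (farr T m).
Proof.
move=> [fullT faithT [F [fullF faithF adj]]] mono_m X p q eq_pq.
have [u [v [vu _]]] := unit_iso fullF faithF adj X.
have [p' Tp'] := fullT _ _ (comp p v).
have [q' Tq'] := fullT _ _ (comp q v).
suff eq_pq' : p' = q'.
  by rewrite -[p]compf1 -[q]compf1 -vu !compfA -Tp' -Tq' eq_pq'.
by apply/mono_m/faithT; rewrite !farr_comp Tp' Tq' !compfA eq_pq.
Qed.

(** * Frames and their homomorphisms *)

Section Frame.
Variable A : frame.

Lemma fsup_ub (X : set A) (x : A) : X x -> x <= fsup X.
Proof. exact: (fsupP X).1. Qed.

Lemma fsup_eq (X : set A) (s : A) : supremums X s -> fsup X = s.
Proof.
by move=> [ub lb]; apply/le_anti/andP; split;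
  [exact: (fsupP X).2 | apply: lb; exact: fsup_ub].
Qed.

Lemma fsup0 : fsup (set0 : set A) = \bot.
Proof. by apply: fsup_eq; split=> // y _; exact: le0x. Qed.

End Frame.

Lemma fhom_bot (A B : frame) (f : frame_hom A B) : f \bot = \bot.
Proof. by rewrite -!fsup0 fhom_sup image_set0. Qed.

Lemma fhom_homo (A B : frame) (f : frame_hom A B) : {homo f : x y / x <= y}.
Proof. by move=> x y /meet_idPl xy; rewrite -xy fhom_meet leIr. Qed.

Definition fhom_inv (A B : frame) (f : frame_hom A B) (g : B -> A) :
  cancel f g -> cancel g f -> frame_hom B A.
Proof.
move=> fK gK; exists g => [x y||X].
- by rewrite -{1}[x]gK -{1}[y]gK -fhom_meet fK.
- by rewrite -[RHS]fK fhom_top.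
- rewrite -[RHS]fK fhom_sup image_comp; congr (g (fsup _)).
  rewrite eqEsubset; split=> [x Xx|_ [x Xx <-]]; last by move: (gK x) => /= ->.
  by exists x => //; exact: gK.
Defined.

(** Together with totality, this makes every monotone map preserving [\bot] and
    [\top] a frame hom; it holds in all chains used below, finite or not. *)
Definition attains_sup (A : frame) :=
  forall X : set A, X !=set0 -> X (fsup X).

Definition chain_hom (A B : frame) (f : A -> B) :
  total (<=%O : rel A) -> attains_sup A -> {homo f : x y / x <= y} ->
  f \bot = \bot -> f \top = \top -> frame_hom A B.
Proof.
move=> totA attA fle f0 f1; exists f => // [x y|X].
  by have [xy|yx] := orP (totA x y);
    [rewrite !meet_l ?fle | rewrite !meet_r ?fle].
have [->|X0] := eqVneq X set0; first by rewrite image_set0 !fsup0.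
apply/esym/fsup_eq; split=> [_ [x Xx <-]|y]; first by apply/fle/fsup_ub.
by apply; exists (fsup X) => //; apply: attA; apply/set0P.
Defined.

(** * Finite chains *)

(** [chain n] has [n.+1] elements; [chain 2] is convertible to [sierpinski]. *)
Definition chain (n : nat) : frame := Frm 'I_n.+1.

Lemma chain_attains n : attains_sup (chain n).
Proof.
move=> X [x Xx].
case: (@arg_maxnP _ x (fun i : 'I_n.+1 => `[< X i >]) val) =>
    [|i /asboolP Xi imax]; first exact/asboolP.
rewrite (_ : fsup X = i) //; apply: fsup_eq; split=> [j Xj|y]; last exact.
by apply: imax; apply/asboolP.
Qed.

Definition ichain_hom (n : nat) (B : frame) (f : chain n -> B) :
  {homo f : x y / x <= y} -> f \bot = \bot -> f \top = \top ->
  frame_hom (chain n) B :=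
  @chain_hom (chain n) B f (@le_total _ 'I_n.+1) (@chain_attains n).

Definition two : frame := chain 1.

Lemma two_dichotomy (i : two) : i = \bot \/ i = \top.
Proof. by case: i => [[|[|i]] lti] //; [left|right]; apply: val_inj. Qed.

Lemma two_neq : (\bot : two) <> \top.
Proof. by []. Qed.

Definition threshold_hom (A : frame) (p : pred A) :
  total (<=%O : rel A) -> attains_sup A ->
  {homo p : x y / x <= y >-> x ==> y} -> p \bot = false -> p \top = true ->
  frame_hom A two.
Proof.
move=> totA attA ple p0 p1.
apply: (@chain_hom A two (fun x => if p x then \top else \bot)) => //.
- by move=> x y /ple; case: (p x) (p y) => [] [].
- by rewrite p0.
- by rewrite p1.
Defined.

Definition cut (n k : nat) (ltkn : (k < n)%N) : frame_hom (chain n) two.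
Proof.
apply: (@threshold_hom (chain n) (fun i : 'I_n.+1 => (k < i)%N)) => //.
- exact: (@le_total _ 'I_n.+1).
- exact: chain_attains.
- by move=> i j ij; apply/implyP=> /leq_trans; apply.
Defined.

(** The larger of two distinct elements is separated from the smaller one by the
    cut at the smaller one. *)
Lemma cut_inj (n : nat) (i j : chain n) :
  (forall k (ltkn : (k < n)%N), cut ltkn i = cut ltkn j) -> i = j.
Proof.
move=> eq_cut; apply/eqP; rewrite eq_le; apply/andP.
suff le_cut (x y : 'I_n.+1) :
    (forall k (ltkn : (k < n)%N), cut ltkn x = cut ltkn y) -> (x <= y)%N.
  by split; apply: le_cut => k ltkn; rewrite eq_cut.
move=> {i j eq_cut} eq_xy; rewrite leqNgt; apply/negP=> ltyx.
have ltyn : (y < n)%N by apply: leq_trans ltyx _; rewrite -ltnS.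
by have := eq_xy _ ltyn; rewrite /= ltyx ltnn => /esym/two_neq.
Qed.

(** * The Sierpinski frame as a free frame *)

Definition gen : sierpinski := @Ordinal 3 1 isT.

Definition classify (L : frame) (x : L) : frame_hom sierpinski L.
Proof.
apply: (@ichain_hom 2 L (fun i : 'I_3 => nth \top [:: \bot; x] i)) => //.
by move=> [[|[|[|i]]] ilt] [[|[|[|j]]] jlt] //= _; rewrite ?le0x ?lex1.
Defined.

Lemma sierpinskiP (i : sierpinski) : [\/ i = \bot, i = gen | i = \top].
Proof.
by case: i => [[|[|[|i]]] lti] //; [constructor 1|constructor 2|constructor 3];
  apply: val_inj.
Qed.

Lemma sierpinski_ext (L : frame) (f g : frame_hom sierpinski L) :
  f gen = g gen -> f = g.
Proof.
move=> fg; apply: frame_hom_eq => i.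
by case: (sierpinskiP i) => ->; rewrite ?fhom_bot ?fhom_top.
Qed.

Lemma classifyK (L : frame) (f : frame_hom sierpinski L) : classify (f gen) = f.
Proof. exact: sierpinski_ext. Qed.

Lemma sierpinski_le (L : frame) (f g : frame_hom sierpinski L) :
  fhom_le f g <-> f gen <= g gen.
Proof.
split=> [|fg i]; first exact.
by case: (sierpinskiP i) => -> //; rewrite ?fhom_bot ?fhom_top.
Qed.

(** Elements are homs out of [sierpinski], so monicity against the single object
    [sierpinski] already gives injectivity. *)
Lemma mono_inj (A B : frame) (m : frame_hom A B) :
  @mono frames A B m -> injective m.
Proof.
move=> mono_m x y mxy.
have /(congr1 (fun f : frame_hom _ _ => f gen)) // :
  classify x = classify y.
by apply: mono_m; apply: sierpinski_ext.
Qed.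

(** The four-element chain is the free frame on two comparable elements. *)
Definition chain4 (L : frame) (x y : L) (xy : x <= y) : frame_hom (chain 3) L.
Proof.
apply: (@ichain_hom 3 L (fun i : 'I_4 => nth \top [:: \bot; x; y] i)) => //.
by move=> [[|[|[|[|i]]]] ilt] [[|[|[|[|j]]]] jlt] //= _; rewrite ?le0x ?lex1.
Defined.

(** * A descending sequence with infimum [\bot] *)

(** The chain [0 < ... < 1/3 < 1/2 < 1]: [Some n] stands for [1/(n+1)] and
    [None] for [0]. *)
Definition invnat := option nat.

HB.instance Definition _ := Choice.on invnat.

Definition invnat_le (x y : invnat) : bool :=
  match x, y with
  | None, _ => true
  | Some m, Some n => (n <= m)%N
  | Some _, None => false
  end.

Lemma invnat_le_refl : reflexive invnat_le.
Proof. by case=> [n|] /=. Qed.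

Lemma invnat_le_anti : antisymmetric invnat_le.
Proof.
by case=> [m|] [n|] //= mn; congr Some; apply: anti_leq; rewrite andbC.
Qed.

Lemma invnat_le_trans : transitive invnat_le.
Proof. by case=> [m|] [n|] [p|] //= mn pm; apply: leq_trans pm mn. Qed.

Lemma invnat_le_total : total invnat_le.
Proof. by case=> [m|] [n|] //=; exact: leq_total. Qed.

HB.instance Definition _ := Order.Le_isPOrder.Build (Order.Disp tt tt) invnat
  invnat_le_refl invnat_le_anti invnat_le_trans.
HB.instance Definition _ := Order.POrder_isTotal.Build _ invnat invnat_le_total.
HB.instance Definition _ := @Order.hasBottom.Build _ invnat None (fun=> isT).
Lemma invnat_lex1 (x : invnat) : x <= Some 0%N.
Proof. by case: x. Qed.
HB.instance Definition _ := @Order.hasTop.Build _ invnat (Some 0%N) invnat_lex1.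

Lemma invnat_sup (X : set invnat) :
  exists s, supremums X s /\ (X !=set0 -> X s).
Proof.
have [[m Xm]|Xn] := pselect (exists m, X (Some m)).
  have exX : exists m, `[< X (Some m) >] by exists m; apply/asboolP.
  case: (ex_minnP exX) => s /asboolP Xs smin; exists (Some s); split=> //.
  split=> [[n|] // Xn|y]; last exact.
  by apply: smin; apply/asboolP.
exists None; split.
  by split=> // -[n|] // Xn'; case: Xn; exists n.
by move=> [[n|] //] Xn'; case: Xn; exists n.
Qed.

Definition invnat_fsup (X : set invnat) : invnat := projT1 (cid (invnat_sup X)).

Lemma invnat_fsupP (X : set invnat) : supremums X (invnat_fsup X).
Proof. exact: (projT2 (cid (invnat_sup X))).1. Qed.

Lemma invnat_fsup_in (X : set invnat) : X !=set0 -> X (invnat_fsup X).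
Proof. exact: (projT2 (cid (invnat_sup X))).2. Qed.

Lemma invnat_meet_fsupr (a : invnat) (B : set invnat) :
  a `&` invnat_fsup B = invnat_fsup [set a `&` b | b in B].
Proof.
apply/le_anti/andP; split; last first.
  apply: (invnat_fsupP _).2 => _ [b Bb <-].
  by rewrite leI2 //; apply: (invnat_fsupP B).1.
have [->|/set0P B0] := eqVneq B set0.
  have -> : invnat_fsup set0 = \bot.
    by apply/le_anti; rewrite le0x andbT; apply: (invnat_fsupP _).2.
  by rewrite meetx0 le0x.
apply: (invnat_fsupP _).1; exists (invnat_fsup B) => //.
exact: invnat_fsup_in.
Qed.

HB.instance Definition _ :=
  isFrame.Build _ invnat invnat_fsupP invnat_meet_fsupr.

Definition invnat_frame : frame := Frm invnat.

Definition positive_point : frame_hom invnat_frame two.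
Proof.
apply: (@threshold_hom invnat_frame isSome) => //.
- exact: invnat_le_total.
- exact: invnat_fsup_in.
- by case=> [m|] [n|].
Defined.

Definition above_point (m : nat) : frame_hom invnat_frame two.
Proof.
apply: (@threshold_hom invnat_frame (fun x => invnat_le (Some m) x)) => //.
- exact: invnat_le_total.
- exact: invnat_fsup_in.
- by move=> x y xy; apply/implyP=> mx; apply: invnat_le_trans mx xy.
Defined.

(** * Natural bijections are order isomorphisms *)

Section NaturalBijection.
Variables (T : functor frames frames)
  (tau : forall L : frame, L -> (T L : frame)).

Let Tmap (L M : frame) (f : frame_hom L M) :
  frame_hom (T L : frame) (T M : frame) := @farr _ _ T L M f.

Hypothesis fullT : full T.
Hypothesis tau_nat : forall (L M : frame) (f : frame_hom L M) (x : L),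
  tau (f x) = Tmap f (tau x).
Hypothesis tau_inj : forall L : frame, injective (@tau L).
Hypothesis tau_surj : forall (L : frame) (y : (T L : frame)),
  exists x : L, tau x = y.

(** Otherwise [tau] exchanges [\bot] and [\top] on [two].  In [T invnat_frame]
    let [tau z] be the supremum of the [tau (1/(n+1))].  As [positive_point]
    sends every [1/(n+1)] to [\top] and its image under [T] preserves suprema,
    it sends [z] to [\top], so [z] is some [1/(m+1)].  But then the image under
    [T] of [above_point m] is not monotone at [tau (1/(m+2)) <= tau z]: its
    values there are [tau \bot = \top] and [tau \top = \bot]. *)
Lemma tau_two_bot : tau (\bot : two) = \bot.
Proof.
have [i tau_i] := tau_surj (\bot : (T two : frame)).
case: (two_dichotomy i) tau_i => -> // tau1; exfalso.
pose x n : invnat_frame := Some n.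
have [z tau_z] := tau_surj (fsup [set tau (x n) | n in setT]).
have pz : positive_point z = \top.
  apply: tau_inj; rewrite tau_nat tau_z fhom_sup tau1.
  apply: fsup_eq; split=> [_ [_ [n _ <-] <-]|y _]; last exact: le0x.
  by rewrite -tau_nat /= tau1.
case: z tau_z pz => [m|] tau_z pz; last by case: two_neq.
have le_z : tau (x m.+1) <= tau (Some m : invnat_frame).
  by rewrite tau_z; apply: fsup_ub; exists m.+1.
have := fhom_homo (Tmap (above_point m)) le_z.
rewrite -!tau_nat /= leqnn ltnn tau1 lex0 -tau1 => /eqP /tau_inj.
exact: two_neq.
Qed.

Lemma tau_mono_two (i j : two) : i <= j -> tau i <= tau j.
Proof.
case: (two_dichotomy i) => ->; first by rewrite tau_two_bot le0x.
by rewrite le1x => /eqP ->.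
Qed.

(** The meet of [tau i] and [tau j] is some [tau k].  All points of the chain
    send [k] and [i] to the same value, as [tau] is monotone on [two]. *)
Lemma tau_mono_chain (n : nat) (i j : chain n) : i <= j -> tau i <= tau j.
Proof.
move=> ij; have [k tau_k] := tau_surj (tau i `&` tau j).
suff <- : k = i by rewrite tau_k leIr.
apply: cut_inj => c ltcn; apply: tau_inj.
rewrite tau_nat tau_k fhom_meet -!tau_nat.
by apply/meet_idPl/tau_mono_two/fhom_homo.
Qed.

Lemma tau_chain_hom (n : nat) :
  exists f : frame_hom (chain n) (T (chain n) : frame), f =1 @tau (chain n).
Proof.
have tau0 : tau (\bot : chain n) = \bot.
  have [i tau_i] := tau_surj (\bot : (T (chain n) : frame)).
  by apply/eqP; rewrite -lex0 -tau_i; apply/tau_mono_chain/le0x.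
have tau1 : tau (\top : chain n) = \top.
  have [i tau_i] := tau_surj (\top : (T (chain n) : frame)).
  by apply/eqP; rewrite -le1x -tau_i; apply/tau_mono_chain/lex1.
by exists (ichain_hom (@tau_mono_chain n) tau0 tau1).
Qed.

(** Naturality along [chain4] carries an inequality from the four-element chain
    to [L].  Conversely [tau x <= tau y] gives a hom from that chain to [T L];
    as the chain is isomorphic to its image under [T] by [tau] itself, this hom
    is [T] of a hom to [L], which witnesses [x <= y]. *)
Lemma tau_le (L : frame) (x y : L) : (tau x <= tau y) = (x <= y).
Proof.
pose lo : chain 3 := @Ordinal 4 1 isT; pose hi : chain 3 := @Ordinal 4 2 isT.
apply/idP/idP=> [txy|xy]; last first.
  have le_lohi : tau lo <= tau hi by apply: tau_mono_chain.
  by have := fhom_homo (Tmap (chain4 xy)) le_lohi; rewrite -!tau_nat.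
have [f fE] := tau_chain_hom 3.
have /choice[g gK] := @tau_surj (chain 3).
have fgK : cancel g f by move=> w; rewrite fE gK.
have gfK : cancel f g by move=> i; apply: tau_inj; rewrite gK fE.
have [k Tk] := @fullT (chain 3) L (frame_comp (chain4 txy) (fhom_inv gfK fgK)).
have kE (i : chain 3) : tau ((k : frame_hom _ _) i) = chain4 txy i.
  by rewrite tau_nat /Tmap Tk /= -fE gfK.
have -> : x = (k : frame_hom _ _) lo by apply: tau_inj; rewrite kE.
have -> : y = (k : frame_hom _ _) hi by apply: tau_inj; rewrite kE.
exact: fhom_homo.
Qed.

End NaturalBijection.

(** * Equivalences fix the Sierpinski frame *)

(** Two homs out of a frame consisting of [\bot] and [\top] are equal, whereas
    the images under [G] of the two homs [sierpinski -> two] are distinct. *)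
Lemma faithful_proper_element (G : functor frames frames) :
  faithful G -> exists z : (G sierpinski : frame), z <> \bot /\ z <> \top.
Proof.
move=> faithG; apply: contrapT => no_z.
have extremal (w : (G sierpinski : frame)) : w = \bot \/ w = \top.
  apply: contrapT => /not_orP ww; apply: no_z; exists w; tauto.
have /faithG/(congr1 (fun f : frame_hom _ _ => f gen)) :
    farr G (classify (\bot : two) : @arr frames sierpinski two) =
    farr G (classify (\top : two) : @arr frames sierpinski two).
  apply: frame_hom_eq => w.
  by case: (extremal w) => ->; rewrite ?fhom_bot ?fhom_top.
exact: two_neq.
Qed.

Lemma classify_inj (L : frame) (x : L) :
  x <> \bot -> x <> \top -> injective (classify x).
Proof.
move=> x0 x1 i j.
have bt : (\bot : L) <> \top.
  by move=> bt; apply: x0; apply/le_anti; rewrite le0x bt lex1.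
by case: (sierpinskiP i) => ->; case: (sierpinskiP j) => -> //=;
  rewrite ?fhom_bot ?fhom_top //= => // /esym.
Qed.

(** The composite of [classify z] with an embedding of [T sierpinski] into
    [sierpinski] is an injective endomorphism of [sierpinski], hence the
    identity, so the embedding is onto. *)
Lemma sierpinski_fixed (T : functor frames frames) :
  is_equivalence T ->
  exists (e : frame_hom sierpinski (T sierpinski : frame))
         (j : frame_hom (T sierpinski : frame) sierpinski),
    cancel e j /\ cancel j e.
Proof.
move=> eqT; have [_ faithT [F [fullF faithF adj]]] := eqT.
have [z [z0 z1]] := faithful_proper_element faithT.
have [x [x0 x1]] := faithful_proper_element faithF.
have [u [v [_ uv]]] := unit_iso fullF faithF adj sierpinski.
pose m : @arr frames sierpinski (F sierpinski) := classify x.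
have mono_m : mono m.
  move=> X p q eq_pq; apply: frame_hom_eq => w.
  apply: (classify_inj x0 x1).
  exact: (congr1 (fun f : frame_hom X (F sierpinski : frame) => f w) eq_pq).
have Tm_inj : injective (farr T m : frame_hom _ _).
  exact: mono_inj (equivalence_mono eqT mono_m).
pose j : frame_hom (T sierpinski : frame) sierpinski :=
  frame_comp (v : frame_hom _ _) (farr T m : frame_hom _ _).
have v_inj : injective (v : frame_hom _ _).
  apply: (can_inj (g := (u : frame_hom _ _))) => w.
  exact: (congr1 (fun f : frame_hom _ _ => f w) uv).
have j_inj : injective j by move=> w1 w2 /v_inj/Tm_inj.
have je : cancel (classify z) j.
  suff je1 : frame_comp j (classify z) = frame_id sierpinski.
    by move=> i; exact: (congr1 (fun f : frame_hom _ _ => f i) je1).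
  apply: sierpinski_ext => /=; change (j z = gen).
  case: (sierpinskiP (j z)) => // jz; exfalso.
    by apply/z0/j_inj; rewrite jz fhom_bot.
  by apply/z1/j_inj; rewrite jz fhom_top.
by exists (classify z), j; split=> // w; apply: j_inj; rewrite je.
Qed.

(** * The theorem *)

Theorem lemma7p6 (T : functor frames frames) (hT : is_equivalence T)
    (L : frame) :
  (forall f g : @arr frames sierpinski L,
     fhom_le f g -> fhom_le (farr T f) (farr T g)) /\
  exists U : @arr frames (T sierpinski) (T L) -> @arr frames sierpinski L,
    [/\ forall h k : @arr frames (T sierpinski) (T L),
          fhom_le h k -> fhom_le (U h) (U k),
        cancel (fun f : @arr frames sierpinski L => farr T f) U
      & cancel U (fun f : @arr frames sierpinski L => farr T f)].
Proof.
have [fullT faithT _] := hT.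
have [e [j [eK jK]]] := sierpinski_fixed hT.
(* Homs out of [T sierpinski] are determined by their value at [e gen], so [T]
   acts on homs out of [sierpinski] as a map of elements. *)
pose tau (M : frame) (x : M) : (T M : frame) :=
  (@farr _ _ T sierpinski M (classify x) : frame_hom _ _) (e gen).
have tauE (M : frame) (f : frame_hom sierpinski M) :
    (@farr _ _ T sierpinski M f : frame_hom _ _) (e gen) = tau M (f gen).
  by rewrite /tau classifyK.
have ext_e (M : frame) (h k : frame_hom (T sierpinski : frame) M) :
    h (e gen) = k (e gen) -> h = k.
  move=> hk; apply: frame_hom_eq => w; rewrite -(jK w).
  by have /(congr1 (fun f : frame_hom _ _ => f (j w))) :
    frame_comp h e = frame_comp k e by apply: sierpinski_ext.
have le_e (M : frame) (h k : frame_hom (T sierpinski : frame) M) :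
    fhom_le h k <-> h (e gen) <= k (e gen).
  split=> [|hk w]; first exact.
  rewrite -(jK w).
  exact: ((sierpinski_le (frame_comp h e) (frame_comp k e)).2 hk (j w)).
have tau_nat (M N : frame) (f : frame_hom M N) (x : M) :
    tau N (f x) = (@farr _ _ T M N f : frame_hom _ _) (tau M x).
  rewrite /tau.
  have -> : classify (f x) = frame_comp f (classify x) by exact: sierpinski_ext.
  exact: (congr1 (fun g : frame_hom _ _ => g (e gen))
            (@farr_comp _ _ T _ _ _ (f : @arr frames M N) (classify x))).
have tau_inj (M : frame) : injective (tau M).
  by move=> x y /ext_e/faithT/(congr1 (fun f : frame_hom _ _ => f gen)).
have tau_surj (M : frame) (y : (T M : frame)) : exists x : M, tau M x = y.
  have [f Tf] := fullT sierpinski M (frame_comp (classify y) j).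
  by exists ((f : frame_hom _ _) gen); rewrite -tauE Tf /= eK.
have lift_le (f g : frame_hom sierpinski L) :
    fhom_le (@farr _ _ T sierpinski L f) (@farr _ _ T sierpinski L g) <->
    fhom_le f g.
  by rewrite le_e !tauE tau_le // sierpinski_le.
split=> [f g /lift_le //|].
have /choice[U UK] := fullT sierpinski L.
exists U; split=> // [h k hk|f].
  by apply/lift_le; rewrite !UK.
by apply: faithT; rewrite UK.
Qed.
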